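(* Let $N$ be a positive integer. If $N\equiv 2\pmod 3$, then there is no regular $D(N)$-triple of triangular numbers.
   Context: For a positive integer $m$, $T_m=m(m+1)/2$ denotes the $m$-th triangular number. For a positive integer $N$, a $D(N)$-triple is a set of three distinct positive integers such that the product of any two distinct elements, increased by $N$, is a perfect square. A $D(N)$-triple $\{T_a,T_b,T_c\}$ with $1\le a<b<c$ is called regular if $T_c=T_a+T_b+2\sqrt{T_aT_b+N}$, equivalently $(T_c-T_a-T_b)^2=4(T_aT_b+N)$. *)

(* Defs.v *)
From mathcomp Require Import all_boot all_order all_algebra all_field.
From mathcomp Require Import finmap.

Set Implicit Arguments.
Unset Strict Implicit.
Unset Printing Implicit Defensive.

Import GRing.Theory Num.Theory.

Local Open Scope fset_scope.

Definition triangular (m : nat) : nat := (m * (m + 1)) %/ 2.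

Definition perfect_square (n : nat) : Prop := exists r : nat, n = r ^ 2.

Definition D_triple (N : nat) (A : {fset nat}) : Prop :=
  [/\ #|` A| = 3,
      (forall x, x \in A -> 0 < x)
    & (forall x y, x \in A -> y \in A -> x <> y -> perfect_square (x * y + N))].

(* The square root is taken in algC, where [sqrtC] of a nonnegative element is
   its nonnegative square root. *)
Definition regular (N a b c : nat) : Prop :=
  ((triangular c)%:R = (triangular a)%:R + (triangular b)%:R
     + 2 * sqrtC ((triangular a * triangular b + N)%:R) :> algC)%R.

Definition regular_triangular_D_triple (N : nat) (A : {fset nat}) : Prop :=
  D_triple N A /\
  exists a b c : nat,
    [/\ 1 <= a, a < b, b < c,
        A = [fset triangular a; triangular b; triangular c]
      & regular N a b c].

(* Main.v *)
(* Modulo 3 a triangular number is 0 or 1 and a square is 0 or 1. If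
   N = 2 mod 3 and T_a T_b + N = r^2, then T_a T_b = 0 would make r^2 = 2, so
   T_a = T_b = 1 and 3 | r. Regularity then gives T_c = T_a + T_b + 2 r = 2
   mod 3, which is impossible. *)
Require Import Defs.
From mathcomp Require Import all_boot all_order all_algebra all_field.
From mathcomp Require Import finmap.

Lemma triangular_double (m : nat) : triangular m * 2 = m * (m + 1).
Proof. by rewrite divnK // dvdn2 oddM oddD /= addbT andbN. Qed.

Lemma triangular_lt (a b : nat) : a < b -> triangular a < triangular b.
Proof.
move=> lt_ab; rewrite -(@ltn_pmul2r 2) // !triangular_double.
by apply: ltn_mul => //; rewrite ltn_add2r.
Qed.

(** Doubling removes the division: [m * (m + 1)] is 0 or 2 mod 3, whereas twice a number congruent
    to 2 is 1. *)
Lemma triangular_mod3 (m : nat) : triangular m %% 3 < 2.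
Proof.
have: (triangular m * 2) %% 3 = (m * (m + 1)) %% 3 by rewrite triangular_double.
rewrite -modnMml -[RHS]modnMm -(modnDml m).
have: triangular m %% 3 < 3 by rewrite ltn_mod.
have: m %% 3 < 3 by rewrite ltn_mod.
by case: (m %% 3) => [|[|[|]]] // _; case: (triangular m %% 3) => [|[|[|]]].
Qed.

(** Besides excluding residue 2, this form retains that residue 0 forces 3 to divide [r]. *)
Lemma sqr_mod3 (r : nat) : r ^ 2 %% 3 = (r %% 3 != 0).
Proof.
by rewrite -modnXm; have: r %% 3 < 3 by [rewrite ltn_mod];
  case: (r %% 3) => [|[|[|]]].
Qed.

(** Leaves [algC]: as [r] is nonnegative, [sqrtC] of its square is [r] itself, and the naturals
    embed injectively. *)
Lemma regular_nat (N a b c r : nat) :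
  triangular a * triangular b + N = r ^ 2 -> regular N a b c ->
  triangular c = triangular a + triangular b + 2 * r.
Proof.
rewrite /regular => -> /eqP.
rewrite GRing.natrX Num.Theory.sqrCK ?Num.Theory.ler0n //.
by rewrite -GRing.natrM -!GRing.natrD Num.Theory.eqr_nat => /eqP.
Qed.

Theorem theorem3p3 (N : nat) (N_gt0 : 0 < N) (N_mod3 : N = 2 %[mod 3]) :
  ~ exists A : {fset nat}, regular_triangular_D_triple N A.
Proof.
case=> A [[_ _ sqA] [a [b [c [_ lt_ab _ defA reg]]]]].
have [||neq_ab|r eq_r] := sqA (triangular a) (triangular b).
- by rewrite defA !inE eqxx.
- by rewrite defA !inE eqxx orbT.
- by have := triangular_lt _ _ lt_ab; rewrite neq_ab ltnn.
have eq_c := regular_nat _ _ _ _ _ eq_r reg.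
have := sqr_mod3 r; rewrite -eq_r -modnDm -modnMm N_mod3.
have := triangular_mod3 c; rewrite eq_c -modnDm -(modnDm (triangular a)) -(modnMm 2).
have r_lt3 : r %% 3 < 3 by rewrite ltn_mod.
(* Of the twelve residue triples for T_a, T_b, [r], only (1, 1, 0) meets the square congruence; it
   makes T_c equal to 2 mod 3, against the bound. *)
case: (triangular a %% 3) (triangular_mod3 a) => [|[|]] // _;
case: (triangular b %% 3) (triangular_mod3 b) => [|[|]] // _;
by case: (r %% 3) r_lt3 => [|[|[|]]].
Qed.
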